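(* Let $\widehat G_{\theta,\lambda}(f)\in V_{\mathrm{out}}^{m_2}$ be an FB-C2CNet prediction for an input $f\in X$. Then $$\|G(f)-\widehat G_{\theta,\lambda}(f)\|_Y^2=\varepsilon_{\mathrm{out}}(G(f))^2+\|P_{\mathrm{out}}G(f)-\widehat G_{\theta,\lambda}(f)\|_Y^2 .$$ In particular, $$\varepsilon_{\mathrm{out}}(G(f))\le\|G(f)-\widehat G_{\theta,\lambda}(f)\|_Y .$$
   Context: $X$ is a space of real-valued input functions, $Y$ is a (real) Hilbert space, and $G:X\to Y$ is an operator. The prescribed output space is the finite-dimensional subspace $V_{\mathrm{out}}^{m_2}=\operatorname{span}\{\psi_j\}_{j=1}^{m_2}\subset Y$ for fixed $\psi_1,\dots,\psi_{m_2}\in Y$, and $P_{\mathrm{out}}:Y\to V_{\mathrm{out}}^{m_2}$ is the orthogonal projection. For $u\in Y$, $$\varepsilon_{\mathrm{out}}(u)=\|u-P_{\mathrm{out}}u\|_Y=\inf_{v\in V_{\mathrm{out}}^{m_2}}\|u-v\|_Y .$$ An FB-C2CNet prediction is the element $\widehat G_{\theta,\lambda}(f)=\sum_{j=1}^{m_2}[N_\theta(\mathbf a_\lambda(f))]_j\,\psi_j$ of $V_{\mathrm{out}}^{m_2}$, where $N_\theta:\mathbb R^{m_1}\to\mathbb R^{m_2}$ is a (neural network) map with parameter $\theta$, and $\mathbf a_\lambda(f)=(\Phi^\top\Phi+\lambda I)^{-1}\Phi^\top\mathbf f$ with $\lambda>0$, $\mathbf f=(f(\mathbf x_1),\dots,f(\mathbf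 x_{n_1}))^\top$ the vector of samples of $f$ at fixed observation points, and $\Phi\in\mathbb R^{n_1\times m_1}$, $\Phi_{ij}=\varphi_j(\mathbf x_i)$, for fixed input basis functions $\varphi_1,\dots,\varphi_{m_1}$. *)

(* Defs.v *)
From HB Require Import structures.
From mathcomp Require Import all_boot all_order all_algebra.
From mathcomp Require Import all_classical all_reals all_analysis.

Set Implicit Arguments.
Unset Strict Implicit.
Unset Printing Implicit Defensive.

Import Order.TTheory GRing.Theory Num.Theory.
Import numFieldNormedType.Exports.

Local Open Scope classical_set_scope.
Local Open Scope ring_scope.

(* A real Hilbert space: a complete normed module whose norm comes from a
   symmetric positive definite bilinear form. *)
HB.mixin Record CompleteNormedModule_isHilbert (R : realType) Y
    of CompleteNormedModule R Y := {
  inner : {dot Y for (@idfun R)} ;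
  sqr_norm_inner : forall y : Y, `|y| ^+ 2 = inner y y
}.

#[short(type="hilbertType")]
HB.structure Definition Hilbert (R : realType) :=
  {Y of CompleteNormedModule_isHilbert R Y & CompleteNormedModule R Y}.

Arguments inner {R Y} : rename.

Section OutputSpace.
Context {R : realType} {Y : hilbertType R}.

Definition lin_span m (psi : 'I_m -> Y) : set Y :=
  range (fun c : 'I_m -> R => \sum_(j < m) c j *: psi j).

Definition is_orth_proj (V : set Y) (u p : Y) : Prop :=
  V p /\ forall v, V v -> inner (u - p) v = 0.

(* Such a point [p] is unique when [V] is a linear subspace, and exists when [V]
   is moreover closed, in particular finite-dimensional; the default 0 is only
   there to make the function total. *)
Definition orth_proj (V : set Y) (u : Y) : Y :=
  xget 0 [set p | is_orth_proj V u p].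

(* This is also the infimum of [`|u - v|] over [v] in the span. *)
Definition out_error m (psi : 'I_m -> Y) (u : Y) : R :=
  `|u - orth_proj (lin_span psi) u|.

End OutputSpace.

Section FBC2CNet.
Context {R : realType} {Omega : Type} {Y : hilbertType R}.
Context {n1 m1 m2 : nat}.

Definition samples (x : 'I_n1 -> Omega) (f : Omega -> R) : 'cV[R]_n1 :=
  \col_i f (x i).

Definition design_mx (x : 'I_n1 -> Omega) (phi : 'I_m1 -> Omega -> R) :
    'M[R]_(n1, m1) :=
  \matrix_(i, j) phi j (x i).

(* For 0 < lambda the matrix inverted here is positive definite, so [invmx] is
   its actual inverse. *)
Definition ridge_coef (x : 'I_n1 -> Omega) (phi : 'I_m1 -> Omega -> R)
    (lambda : R) (f : Omega -> R) : 'cV[R]_m1 :=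
  let Phi := design_mx x phi in
  invmx (Phi^T *m Phi + lambda%:M) *m Phi^T *m samples x f.

(* [N] is the network with its parameter already fixed. *)
Definition fb_c2cnet (x : 'I_n1 -> Omega) (phi : 'I_m1 -> Omega -> R)
    (psi : 'I_m2 -> Y) (N : 'cV[R]_m1 -> 'cV[R]_m2) (lambda : R)
    (f : Omega -> R) : Y :=
  \sum_(j < m2) N (ridge_coef x phi lambda f) j 0 *: psi j.

End FBC2CNet.

(* Main.v *)
Require Import Defs.
From HB Require Import structures.
From mathcomp Require Import all_boot all_order all_algebra.
From mathcomp Require Import all_classical all_reals all_analysis.

Set Implicit Arguments.
Unset Strict Implicit.
Unset Printing Implicit Defensive.

Import Order.TTheory GRing.Theory Num.Theory.
Import numFieldNormedType.Exports.

Local Open Scope classical_set_scope.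
Local Open Scope ring_scope.

(** Let [V] be the span of the [psi j], [u] the target [G f] and [g] the
prediction. Both [orth_proj V u] and [g], a linear combination of the [psi j],
lie in [V]. Hence so does their difference, which is therefore orthogonal to the
residual [u - orth_proj V u], and the asserted identity is Pythagoras' theorem
for [u - g = (u - orth_proj V u) + (orth_proj V u - g)]
([pythagoras_lin_span]); the inequality follows by dropping the second square.

The one thing to establish is that [orth_proj V u] really is a projection, that
is, that a projection onto the span of finitely many vectors exists
([lin_span_has_orth_proj]). This is an induction on the number of vectors, each
step of which is a Gram-Schmidt step ([gram_schmidt_step]). *)

Section FiniteSpan.
Context {R : realType} {Y : hilbertType R}.
Implicit Types (u v w : Y).

Lemma lin_spanP m (psi : 'I_m -> Y) (a : R) v w :
  lin_span psi v -> lin_span psi w -> lin_span psi (a *: v + w).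
Proof.
move=> [c _ <-] [d _ <-]; exists (fun j => a * c j + d j) => //=.
rewrite scaler_sumr -big_split /=; apply: eq_bigr => j _.
by rewrite scalerDl scalerA.
Qed.

Lemma lin_span_recl m (psi : 'I_m.+1 -> Y) v :
  lin_span psi v <->
  exists a w, lin_span (psi \o lift ord0) w /\ v = a *: psi ord0 + w.
Proof.
split=> [[c _ <-]|[a [_ [[c _ <-] ->]]]].
  exists (c ord0), (\sum_(j < m) c (lift ord0 j) *: psi (lift ord0 j)).
  by rewrite big_ord_recl; split=> //; exists (c \o lift ord0).
exists (fun j => if unlift ord0 j is Some k then c k else a) => //=.
rewrite big_ord_recl unlift_none; congr (_ + _).
by apply: eq_bigr => j _; rewrite liftK.
Qed.

(** The residual [e - q] is orthogonal to [V] and spans, together with [V], the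
same space as [e] does, so projecting onto the larger space amounts to adding
the component of [u] along [e - q]. If [e] already lies in [V], the residual is
zero and the added term vanishes, whatever the value of the coefficient
[0 / 0]. *)
Lemma gram_schmidt_step (V : set Y) (e u p q : Y) :
    is_orth_proj V u p -> is_orth_proj V e q ->
  let r := e - q in
  let c := inner u r / inner r r in
  forall a w, V w -> inner (u - (p + c *: r)) (a *: e + w) = 0.
Proof.
move=> [Vp up] [Vq eqV] r c a w Vw.
have r_orth v : V v -> inner r v = 0 by exact: eqV.
have r_orthC v : V v -> inner v r = 0.
  by move=> Vv; rewrite hermC /= r_orth// mulr0.
have residual_r : inner (u - (p + c *: r)) r = 0.
  rewrite linearBl linearDl /= linearZl /= (r_orthC _ Vp) add0r /c.
  have [r0|r0] := eqVneq (inner r r) 0; last by rewrite divfK// subrr.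
  have -> : r = 0.
    by apply/eqP; rewrite -normr_eq0 -sqrf_eq0 sqr_norm_inner r0.
  by rewrite !linear0r subrr.
have residual_V v : V v -> inner (u - (p + c *: r)) v = 0.
  by move=> Vv; rewrite opprD addrA linearBl /= linearZl /=
    up// r_orth// mulr0 subrr.
have -> : a *: e + w = a *: r + (a *: q + w).
  by rewrite addrA -scalerDr subrK.
rewrite (linearPr inner) (linearPr inner) /=.
by rewrite residual_r !residual_V// !mulr0 !addr0.
Qed.

Lemma lin_span_has_orth_proj m (psi : 'I_m -> Y) u :
  exists p, is_orth_proj (lin_span psi) u p.
Proof.
elim: m psi u => [|m IHm] psi u.
  exists 0; split; first by exists (fun=> 0); rewrite //= big_ord0.
  by move=> _ [c _ <-]; rewrite big_ord0 linear0r.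
have [p up] := IHm (psi \o lift ord0) u.
have [q eqV] := IHm (psi \o lift ord0) (psi ord0).
set r := psi ord0 - q; pose c := inner u r / inner r r.
exists (p + c *: r); split=> [|_ /lin_span_recl[a [w [Vw ->]]]]; last first.
  exact: (gram_schmidt_step up eqV a Vw).
apply/lin_span_recl; exists c, (- c *: q + p); split.
  by apply: lin_spanP; [exact: proj1 eqV | exact: proj1 up].
by rewrite /r scalerDr scalerN scaleNr addrC addrA.
Qed.

Lemma orth_projP m (psi : 'I_m -> Y) u :
  is_orth_proj (lin_span psi) u (orth_proj (lin_span psi) u).
Proof.
by have [p up] := lin_span_has_orth_proj psi u; apply: xgetPex; exists p.
Qed.

Lemma pythagoras_lin_span m (psi : 'I_m -> Y) u g : lin_span psi g ->
  `|u - g| ^+ 2 =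
  out_error psi u ^+ 2 + `|orth_proj (lin_span psi) u - g| ^+ 2.
Proof.
move=> Vg; have [Vp up] := orth_projP psi u; rewrite /out_error.
set p := orth_proj _ _ in Vp up *.
rewrite -[u - g](subrKA p) !sqr_norm_inner hnormDd//; apply: up.
by rewrite addrC -scaleN1r; exact: lin_spanP.
Qed.

End FiniteSpan.

Theorem proposition3p4 (R : realType) (Omega : Type) (X : set (Omega -> R))
    (Y : hilbertType R) (G : X -> Y) (n1 m1 m2 : nat)
    (x : 'I_n1 -> Omega) (phi : 'I_m1 -> Omega -> R) (psi : 'I_m2 -> Y)
    (Theta : Type) (N : Theta -> 'cV[R]_m1 -> 'cV[R]_m2)
    (theta : Theta) (lambda : R) (lambda_gt0 : 0 < lambda) (f : X) :
  let Ghat := fb_c2cnet x phi psi (N theta) lambda (\val f) in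
  let Pout := orth_proj (lin_span psi) in
  `|G f - Ghat| ^+ 2 = out_error psi (G f) ^+ 2 + `|Pout (G f) - Ghat| ^+ 2
  /\ out_error psi (G f) <= `|G f - Ghat|.
Proof.
move=> Ghat Pout.
have pyth : `|G f - Ghat| ^+ 2 =
    out_error psi (G f) ^+ 2 + `|Pout (G f) - Ghat| ^+ 2.
  apply: pythagoras_lin_span.
  by exists (fun j => N theta (ridge_coef x phi lambda (\val f)) j 0).
split=> //; rewrite -ler_sqr ?nnegrE ?normr_ge0//.
by rewrite pyth lerDl sqr_ge0.
Qed.
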